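(* Let $a,x,y$ be indeterminates and let $D=ax\frac{\partial}{\partial a}+xy\frac{\partial}{\partial x}+x^2\frac{\partial}{\partial y}$ be the derivation on polynomials in $a,x,y$ with $D(a)=ax$, $D(x)=xy$, $D(y)=x^2$; for a polynomial $f$ put $\mathrm{Gen}(f,t)=\sum_{n\ge0}D^n(f)\frac{t^n}{n!}$. Then $$(x+y)\,\mathrm{Gen}(a,t)=a\big(\mathrm{Gen}(x,t)+\mathrm{Gen}(y,t)\big),$$ or equivalently, for all $n\ge0$, $$(x+y)\Lambda_n(x,y)=L_n(x,y)+W_n(x,y).$$
   Context: For a permutation $\sigma$ of $[n]$, prepend $\sigma_0=0$; an up-down run is a maximal increasing or decreasing segment of consecutive entries of $\sigma_0\sigma_1\cdots\sigma_n$. $\Lambda(n,k)$ is the number of permutations of $[n]$ with $k$ up-down runs, $\Lambda_n(x,y)=\sum_{k=1}^n\Lambda(n,k)x^ky^{n-k}$ for $n\ge1$ and $\Lambda_0(x,y)=1$. A left peak is an index $1\le i\le n-1$ with $\sigma_{i-1}<\sigma_i>\sigma_{i+1}$ ($\sigma_0=0$); an exterior peak is an index $1\le i\le n$ with $\sigma_{i-1}<\sigma_i>\sigma_{i+1}$ ($\sigma_0=\sigma_{n+1}=0$); $L(n,k)$, $W(n,k)$ count permutations of $[n]$ with $k$ left, resp. exterior, peaks. For $n\ge1$, $L_n(x,y)=\sum_{k=0}^{\lfloor n/2\rfloor}L(n,k)x^{2k+1}y^{n-2k}$, $W_n(x,y)=\sum_{k=1}^{\lfloor(n+1)/2\rfloor}W(n,k)x^{2k}y^{n-2k+1}$,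 and $L_0(x,y)=x$, $W_0(x,y)=y$. *)

(* Defs.v *)
From HB Require Import structures.
From mathcomp Require Import all_boot all_order all_fingroup all_algebra.
From mathcomp Require Import mpoly ring.

Set Implicit Arguments.
Unset Strict Implicit.
Unset Printing Implicit Defensive.

Import GRing.Theory.

(* 'S_n permutes {0, .., n-1}; values are shifted by one so that [entry s i]
   is sigma_i for 1 <= i <= n. The prepended entry gives sigma_0 = 0, and the
   default value of [nth] gives sigma_(n+1) = 0. *)
Definition entry n (s : 'S_n) (i : nat) : nat :=
  nth 0 (0 :: [seq (s j : nat).+1 | j <- enum 'I_n]) i.

Definition monotone_segment n (s : 'S_n) (i j : nat) : bool :=
  (i < j) &&
    ([forall k : 'I_n, (i <= k < j) ==> (entry s k < entry s k.+1)]
     || [forall k : 'I_n, (i <= k < j) ==> (entry s k.+1 < entry s k)]).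

Definition updown_run n (s : 'S_n) (i j : 'I_n.+1) : bool :=
  monotone_segment s i j &&
    [forall i' : 'I_n.+1, forall j' : 'I_n.+1,
       [&& i' <= i, j <= j' & monotone_segment s i' j']
         ==> ((i' == i) && (j' == j))].

Definition num_updown_runs n (s : 'S_n) : nat :=
  #|[set p : 'I_n.+1 * 'I_n.+1 | updown_run s p.1 p.2]|.

Definition is_peak n (s : 'S_n) (i : nat) : bool :=
  (entry s i.-1 < entry s i) && (entry s i.+1 < entry s i).

Definition num_left_peaks n (s : 'S_n) : nat :=
  count (is_peak s) (index_iota 1 n).

Definition num_exterior_peaks n (s : 'S_n) : nat :=
  count (is_peak s) (index_iota 1 n.+1).

Definition Lambda_num (n k : nat) : nat :=
  #|[set s : 'S_n | num_updown_runs s == k]|.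
Definition L_num (n k : nat) : nat :=
  #|[set s : 'S_n | num_left_peaks s == k]|.
Definition W_num (n k : nat) : nat :=
  #|[set s : 'S_n | num_exterior_peaks s == k]|.

Local Open Scope ring_scope.

Definition Lambda_poly (R : comNzRingType) (n : nat) (x y : R) : R :=
  if n is 0 then 1
  else \sum_(1 <= k < n.+1) (Lambda_num n k)%:R * x ^+ k * y ^+ (n - k).

Definition L_poly (R : comNzRingType) (n : nat) (x y : R) : R :=
  if n is 0 then x
  else \sum_(0 <= k < (n./2).+1)
         (L_num n k)%:R * x ^+ (2 * k).+1 * y ^+ (n - 2 * k).

(* The exponent n - 2k + 1 is written n.+1 - 2k: with truncated subtraction
   (n - 2k).+1 would be wrong when 2k = n + 1. *)
Definition W_poly (R : comNzRingType) (n : nat) (x y : R) : R :=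
  if n is 0 then y
  else \sum_(1 <= k < ((n.+1)./2).+1)
         (W_num n k)%:R * x ^+ (2 * k) * y ^+ (n.+1 - 2 * k).

(* Rational coefficients, because of the division by n! in [Gen]. *)
Notation polyaxy := {mpoly rat[3]}.

Definition ia : 'I_3 := @Ordinal 3 0 isT.
Definition ix : 'I_3 := @Ordinal 3 1 isT.
Definition iy : 'I_3 := @Ordinal 3 2 isT.

Definition va : polyaxy := 'X_ia.
Definition vx : polyaxy := 'X_ix.
Definition vy : polyaxy := 'X_iy.

Definition D (f : polyaxy) : polyaxy :=
  va * vx * f^`M(ia) + vx * vy * f^`M(ix) + vx ^+ 2 * f^`M(iy).

Lemma D_leibniz (f g : polyaxy) : D (f * g) = D f * g + f * D g.
Proof. by rewrite /D !mderivM; ring. Qed.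

Lemma mderivU (i j : 'I_3) : ('X_j : polyaxy)^`M(i) = (j == i)%:R.
Proof.
rewrite mderivX mnm1E; case: eqP => [->|_]; last by rewrite scale0r.
have -> : (U_(i) - U_(i) = 0)%MM by apply/mnmP => k; rewrite mnmBE mnm0E subnn.
by rewrite mpolyX0 scale1r.
Qed.

Lemma D_va : D va = va * vx.
Proof. by rewrite /D !mderivU /=; ring. Qed.

Lemma D_vx : D vx = vx * vy.
Proof. by rewrite /D !mderivU /=; ring. Qed.

Lemma D_vy : D vy = vx ^+ 2.
Proof. by rewrite /D !mderivU /=; ring. Qed.

(* Formal power series in t over R, as coefficient sequences; equality of
   series is pointwise equality [=1]. *)
Definition fps (R : Type) : Type := nat -> R.

Definition fps_const (R : comNzRingType) (c : R) : fps R :=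
  fun n => if n is 0 then c else 0.

Definition fps_add (R : comNzRingType) (F G : fps R) : fps R :=
  fun n => F n + G n.

Definition fps_mul (R : comNzRingType) (F G : fps R) : fps R :=
  fun n => \sum_(i < n.+1) F i * G (n - i)%N.

Definition Gen (f : polyaxy) : fps polyaxy :=
  fun n => (n`!%:R : rat)^-1 *: iter n D f.

(* Main.v *)
(** For the generating functions, a and x + y satisfy the same equation
    D u = x u, so D^n a = a P_n and D^n (x + y) = (x + y) P_n with the same P_n.

    The identity between Lambda_n, L_n and W_n holds permutation by permutation.
    The runs of sigma_0 ... sigma_n alternate up, down, up, ..., starting with
    an up-run.  With l left peaks and e exterior peaks, e = l or e = l + 1
    according to whether the last run goes down or up, and the number of runs
    is l + e.  In both cases
    x^(2l+1) y^(n-2l) + x^(2e) y^(n-2e+1) = (x + y) x^(l+e) y^(n-l-e). *)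
Require Import Defs.
From mathcomp Require Import all_boot all_order all_fingroup all_algebra.
From mathcomp Require Import mpoly zify ring.

Set Implicit Arguments.
Unset Strict Implicit.
Unset Printing Implicit Defensive.

Import GRing.Theory.

(** * Runs determined by their starting positions *)

Section Runs.

Variables (n : nat) (s : 'S_n).

Definition ascent (k : nat) : bool := entry s k < entry s k.+1.

Lemma entryS (j : 'I_n) : entry s j.+1 = (s j).+1.
Proof. by rewrite /entry /= (nth_map j) ?size_enum_ord // nth_ord_enum. Qed.

Lemma entry_neq k : k < n -> entry s k != entry s k.+1.
Proof.
case: k => [|k] lt_kn; first by rewrite (entryS (Ordinal lt_kn)).
rewrite (entryS (Ordinal (ltnW lt_kn))) (entryS (Ordinal lt_kn)) eqSS.
by apply/negP => /eqP/val_inj/perm_inj/(congr1 val) /= /n_Sn.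
Qed.

Lemma ascent0 : 0 < n -> ascent 0.
Proof. by move=> n_gt0; rewrite /ascent (entryS (Ordinal n_gt0)). Qed.

Lemma descentE k : k < n -> (entry s k.+1 < entry s k) = ~~ ascent k.
Proof. by move=> /entry_neq; rewrite /ascent; lia. Qed.

(** Consecutive entries differ, so a step that is not an ascent is a descent, and both kinds of
    monotonicity amount to a constant direction. *)
Lemma monotone_segmentP (i j : nat) : j <= n ->
  reflect (i < j /\ forall k, i <= k < j -> ascent k = ascent i)
          (monotone_segment s i j).
Proof.
move=> le_jn; rewrite /monotone_segment.
apply: (iffP andP) => -[lt_ij].
  have iP : i <= i < j by rewrite leqnn.
  have lt_n k : i <= k < j -> k < n by lia.
  case/orP=> /forallP mono; split=> // k kP.
    have := mono (Ordinal (lt_n _ iP)); have := mono (Ordinal (lt_n _ kP)).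
    by rewrite /= iP kP /ascent /= => -> ->.
  have := mono (Ordinal (lt_n _ iP)); have := mono (Ordinal (lt_n _ kP)).
  rewrite /= iP kP /= !descentE ?lt_n //.
  by move=> /negbTE-> /negbTE->.
move=> mono; split=> //; case E: (ascent i); apply/orP; [left|right];
  apply/forallP => k; apply/implyP => kP; rewrite ?descentE //.
  by rewrite -/(ascent k) mono.
by rewrite mono ?E.
Qed.

Definition run_start (i : nat) : bool :=
  (i < n) && ((i == 0) || (ascent i != ascent i.-1)).

(** If the steps before and after [i] had the same direction, the segment could be extended to
    [i.-1], against maximality. *)
Lemma updown_run_start (i j : 'I_n.+1) : updown_run s i j -> run_start i.
Proof.
case/andP=> /monotone_segmentP[|lt_ij mono]; first by rewrite -ltnS.
move=> /forallP/(_ (inord i.-1))/forallP/(_ j).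
have ltiS : i.-1 < n.+1 by have := ltn_ord i; lia.
rewrite /run_start -val_eqE /= inordK // leqnn eqxx leq_pred andbT /= => maxi.
apply/andP; split; first by have := ltn_ord j; lia.
case: posnP => //= i_gt0; apply/negP => /eqP asc_i.
suff seg : monotone_segment s i.-1 j by move: maxi; rewrite seg /=; lia.
apply/monotone_segmentP; first by rewrite -ltnS.
split=> [|k kP]; first lia.
have [->//|ne_k] := eqVneq k i.-1.
by rewrite mono ?asc_i //; lia.
Qed.

Lemma updown_run_inj (i j j' : 'I_n.+1) :
  updown_run s i j -> updown_run s i j' -> j = j'.
Proof.
wlog le_jj' : j j' / j <= j'.
  by move=> wl; have [/wl//|/ltnW/wl sym] := leqP j j'; move=> *; apply/esym/sym.
move=> /andP[_ /forallP/(_ i)/forallP/(_ j')].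
rewrite leqnn le_jj' /= => /implyP maxj /andP[seg _].
by case/andP: (maxj seg) => _ /eqP.
Qed.

(** The longest monotone segment from [i] is a run: a segment containing it and starting earlier
    would cross the turn at [i]. *)
Lemma run_start_updown_run (i : 'I_n.+1) :
  run_start i -> exists j, updown_run s i j.
Proof.
case/andP=> lt_in turn.
have seg0 : monotone_segment s i (inord i.+1 : 'I_n.+1).
  rewrite inordK //; apply/monotone_segmentP => //; split=> // k kP.
  by have -> : k = i by lia.
have [j seg maxj] :=
  @arg_maxnP _ (inord i.+1) (fun j : 'I_n.+1 => monotone_segment s i j)
             (@nat_of_ord _) seg0.
exists j; rewrite /updown_run seg /=.
have [|lt_ij mono] := monotone_segmentP i _ seg; first by rewrite -ltnS.
apply/forallP => i'; apply/forallP => j'; apply/implyP.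
case/and3P=> le_i'i le_jj' seg'.
have [|lt_i'j' mono'] := monotone_segmentP i' _ seg'; first by rewrite -ltnS.
have eq_i : i' = i.
  apply/val_inj/eqP; rewrite /= eqn_leq le_i'i /= leqNgt; apply/negP => lt_i'i.
  case/orP: turn => [/eqP i0|/eqP[]]; first by move: lt_i'i; rewrite i0.
  by rewrite !mono' //; lia.
move: seg'; rewrite eq_i eqxx => /maxj le_j'j.
by apply/eqP/val_inj/eqP; rewrite /= eqn_leq le_jj' andbT.
Qed.

Lemma num_updown_runs_starts :
  num_updown_runs s = #|[set i : 'I_n.+1 | run_start i]|.
Proof.
rewrite /num_updown_runs -(@card_in_imset _ _ fst).
  apply: eq_card => i; rewrite inE; apply/imsetP/idP.
    by case=> -[i' j]; rewrite inE /= => /updown_run_start st ->.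
  by case/run_start_updown_run => j run; exists (i, j); rewrite ?inE.
move=> [i j] [i' j']; rewrite !inE /= => run + eq_i; rewrite -eq_i => run'.
by rewrite (updown_run_inj run run').
Qed.

End Runs.

(** * Runs counted by peaks *)

Lemma iota1S d : iota 1 d.+1 = iota 1 d ++ [:: d.+1].
Proof. by rewrite -[[:: _]]/(iota (1 + d) 1) -iotaD addn1. Qed.

Lemma num_updown_runsE m (s : 'S_m.+1) :
  num_updown_runs s = (count (run_start s) (iota 1 m)).+1.
Proof.
rewrite num_updown_runs_starts -sum1dep_card -(big_mkord (run_start s) (fun=> 1)).
rewrite -[index_iota _ _]/(0 :: iota 1 m.+1) iota1S.
have startsN : ~~ run_start s m.+1 by rewrite /run_start ltnn.
by rewrite sum1_count /= count_cat /= (negbTE startsN) !addn0.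
Qed.

Lemma left_peakE n (s : 'S_n) i : 0 < i < n ->
  is_peak s i = ascent s i.-1 && ~~ ascent s i.
Proof.
by case: i => // i /= lt_in; rewrite /is_peak -/(ascent s i) descentE.
Qed.

(** The first step goes up and every turn flips the direction. A turn from up to down is a peak; a
    turn from down to up is recorded only by the final [ascent s d]. *)
Lemma peaks_and_turns m (s : 'S_m.+1) d : d <= m ->
  (count (run_start s) (iota 1 d)).+1
  = (count (is_peak s) (iota 1 d)).*2 + ascent s d.
Proof.
elim: d => [|d IHd] lt_dm; first by rewrite /= ascent0.
rewrite iota1S !count_cat [count _ [:: _]]/= [count (is_peak s) [:: _]]/=.
have -> : run_start s d.+1 = (ascent s d.+1 != ascent s d).
  by rewrite /run_start ltnS lt_dm.
rewrite left_peakE //= !addn0.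
have := IHd (ltnW lt_dm).
by case: (ascent s d); case: (ascent s d.+1) => /=; lia.
Qed.

(** The only additional candidate is the last position; as the entry after it is 0, it is a peak
    exactly when the last step goes up. *)
Lemma num_exterior_peaksE m (s : 'S_m.+1) :
  num_exterior_peaks s = num_left_peaks s + ascent s m.
Proof.
rewrite /num_exterior_peaks /num_left_peaks /index_iota !subSS !subn0.
have entry_last : entry s m.+2 = 0.
  by rewrite /entry nth_default //= size_map size_enum_ord.
rewrite iota1S count_cat /= addn0 /is_peak entry_last -/(ascent s m).
by have /= -> := entryS s ord_max; rewrite andbT.
Qed.

Lemma num_updown_runs_peaks m (s : 'S_m.+1) :
  num_updown_runs s = (num_left_peaks s).*2 + ascent s m.
Proof.
rewrite num_updown_runsE peaks_and_turns //.
by rewrite /num_left_peaks /index_iota subSS subn0.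
Qed.

Lemma num_updown_runs_bounds m (s : 'S_m.+1) : 0 < num_updown_runs s <= m.+1.
Proof.
by rewrite num_updown_runsE /= ltnS -[leqRHS](size_iota 1) count_size.
Qed.

(** * Summation over permutations *)

Local Open Scope ring_scope.

Lemma sum_card_fibers (R : comNzRingType) (T : finType) (f : T -> nat)
    (a b : nat) (g : nat -> R) :
  (forall t, a <= f t < b)%N ->
  \sum_(a <= k < b) #|[set t | f t == k]|%:R * g k = \sum_t g (f t).
Proof.
move=> fP.
have fiber k : #|[set t | f t == k]|%:R * g k = \sum_(t | f t == k) g (f t).
  rewrite -sum1dep_card natr_sum mulr_suml.
  by apply: eq_bigr => t /eqP <-; rewrite mul1r.
under eq_bigr do rewrite fiber.
rewrite (exchange_big_dep predT) //=; apply: eq_bigr => t _.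
rewrite big_mkcond /= (bigD1_seq (f t)) ?iota_uniq ?mem_index_iota //=.
by rewrite eqxx big1 ?addr0 // => k /negbTE; rewrite eq_sym => ->.
Qed.

Lemma mul_Lambda_poly (R : comNzRingType) (n : nat) (x y : R) :
  (x + y) * Lambda_poly n x y = L_poly n x y + W_poly n x y.
Proof.
case: n => [|m]; first by rewrite mulr1.
rewrite /Lambda_poly /L_poly /W_poly /Lambda_num /L_num /W_num.
under [in LHS]eq_bigr do rewrite -mulrA.
under [X in _ = X + _]eq_bigr do rewrite -mulrA.
under [X in _ = _ + X]eq_bigr do rewrite -mulrA.
have peakP (s : 'S_m.+1) := (num_updown_runs_bounds s,
  num_updown_runs_peaks s, num_exterior_peaksE s).
rewrite (sum_card_fibers (fun k => x ^+ k * y ^+ (m.+1 - k))); last first.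
  by move=> s; rewrite ltnS num_updown_runs_bounds.
(* The ranges of both peak counts follow from the number of runs lying between 1 and n. *)
rewrite (sum_card_fibers (fun k => x ^+ (2 * k).+1 * y ^+ (m.+1 - 2 * k)));
  last by move=> s; have [[]] := peakP s; case: (ascent s m) => /=; lia.
rewrite (sum_card_fibers (fun k => x ^+ (2 * k) * y ^+ (m.+2 - 2 * k)));
  last by move=> s; have [[]] := peakP s; case: (ascent s m) => /=; lia.
rewrite mulr_sumr -big_split /=; apply: eq_bigr => s _.
have [[]] := peakP s; rewrite num_updown_runs_peaks num_exterior_peaksE.
set l := num_left_peaks s; case: (ascent s m) => /= bounds _ _.
  (* Last step up: 2l+1 runs and l+1 exterior peaks. As 2l+1 <= n, no subtraction truncates. *)
  have [-> ->] : (m.+1 - 2 * l = (m.+1 - (l.*2 + 1)).+1 /\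
                 m.+2 - 2 * (l + 1) = m.+1 - (l.*2 + 1))%N by lia.
  by rewrite -mul2n mulnDr !addn1 muln1 addn2 !exprS; ring.
(* Last step down: 2l runs and l exterior peaks. *)
have [-> ->] : (m.+1 - 2 * l = m.+1 - (l.*2 + 0) /\
               m.+2 - 2 * (l + 0) = (m.+1 - (l.*2 + 0)).+1)%N by lia.
by rewrite -mul2n !addn0 !exprS; ring.
Qed.

(** * Generating functions *)

Lemma D_iter_eigen (n : nat) : exists P : polyaxy,
  forall u : polyaxy, D u = vx * u -> iter n D u = u * P.
Proof.
elim: n => [|n [P IHP]]; first by exists 1 => u _; rewrite mulr1.
(* By the Leibniz rule D(uP) = xuP + u D(P), whose cofactor of u does not depend on u. *)
exists (vx * P + D P) => u Du.
by rewrite iterS (IHP u Du) D_leibniz Du; ring.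
Qed.

Lemma D_add (f g : polyaxy) : D (f + g) = D f + D g.
Proof. by rewrite /D !mderivD; ring. Qed.

Lemma iter_D_add (n : nat) (f g : polyaxy) :
  iter n D (f + g) = iter n D f + iter n D g.
Proof. by elim: n => //= n ->; rewrite D_add. Qed.

Lemma fps_const_mulE (R : comNzRingType) (c : R) (F : fps R) n :
  fps_mul (fps_const c) F n = c * F n.
Proof.
by rewrite /fps_mul big_ord_recl subn0 big1 ?addr0 // => i _; rewrite mul0r.
Qed.

Theorem theorem3p3 :
  (fps_mul (fps_const (vx + vy)) (Gen va)
     =1 fps_mul (fps_const va) (fps_add (Gen vx) (Gen vy)))
  /\ (forall n : nat,
        (vx + vy) * Lambda_poly n vx vy = L_poly n vx vy + W_poly n vx vy).
Proof.
split=> n; last exact: mul_Lambda_poly.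
rewrite !fps_const_mulE /fps_add /Gen -scalerDr -!scalerAr -iter_D_add.
have [P eigenP] := D_iter_eigen n.
(* Both coefficients become a(x+y)P/n!; the equations D(u) = xu for u = x+y and u = a remain. *)
rewrite !eigenP; first by congr (_ *: _); ring.
- by rewrite D_add D_vx D_vy; ring.
- by rewrite D_va mulrC.
Qed.
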